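(* For every integer $n\ge 8$, $\alpha(4,n)\le \left\lceil\frac{n+1}{6}\right\rceil$.
   Context: For a graph $G$, $\alpha(G)$ is the maximum size of a stable set (set of pairwise non-adjacent vertices) and $\mathit{cl}(G)$ is the clique complex of $G$ (simplicial complex of cliques). Define $$\alpha(d,n)=\min\{\alpha(G): |V(G)|=n,\ \mathit{cl}(G)\text{ triangulates the }(d-1)\text{-dimensional sphere}\}.$$ *)

(* Defs.v *)
From HB Require Import structures.
From mathcomp Require Import all_boot all_order all_algebra.
From mathcomp Require Import all_classical all_reals topology.
From mathcomp Require Import normedtype.
Import Order.TTheory GRing.Theory Num.Theory.
Import numFieldNormedType.Exports.

Set Implicit Arguments.
Unset Strict Implicit.
Unset Printing Implicit Defensive.

Local Open Scope classical_set_scope.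
Local Open Scope ring_scope.

Record sgraph := SGraph {
  vertex :> finType;
  adj : rel vertex;
  adj_sym : symmetric adj;
  adj_irrefl : irreflexive adj }.

Definition stable_set (G : sgraph) (S : {set G}) : bool :=
  [forall x in S, forall y in S, ~~ adj x y].

Definition stability_number (G : sgraph) : nat :=
  (\max_(S : {set G} | stable_set S) #|S|)%N.

Definition is_clique (G : sgraph) (S : {set G}) : bool :=
  [forall x in S, forall y in S, (x != y) ==> adj x y].

(* As an abstract simplicial complex, it contains the empty face. *)
Definition clique_complex (G : sgraph) : {set {set G}} :=
  [set S : {set G} | is_clique S]%SET.

(* A point of the standard simplex is given by its barycentric coordinates;
   the coordinate at the vertex v is stored in column enum_rank v. *)
Definition bary_support (R : realType) (V : finType) (x : 'rV[R]_#|V|)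
    : {set V} :=
  [set v : V | x ord0 (enum_rank v) != 0]%SET.

Definition geometric_realization (R : realType) (V : finType)
    (K : {set {set V}}) : set 'rV[R]_#|V| :=
  [set x : 'rV[R]_#|V| | [/\ forall i, 0 <= x ord0 i,
                             \sum_i x ord0 i = 1
                           & bary_support x \in K]].

Arguments geometric_realization R {V} K _.

(* The Euclidean sphere S^(d-1) in R^d; the norm `|x| of a matrix is the sup
   norm, so it cannot be used here. *)
Definition unit_sphere (R : realType) (d : nat) : set 'rV[R]_d :=
  [set x : 'rV[R]_d | \sum_i x ord0 i ^+ 2 = 1].

Arguments unit_sphere R d _ : clear implicits.

(* Homeomorphism between A and B with their subspace topologies; values of f
   outside A and of g outside B are irrelevant. *)
Definition homeomorphic (X Y : topologicalType) (A : set X) (B : set Y) : Prop :=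
  exists (f : X -> Y) (g : Y -> X),
    [/\ set_fun A B f /\ set_fun B A g,
        {within A, continuous f},
        {within B, continuous g},
        (forall x, A x -> g (f x) = x)
      & (forall y, B y -> f (g y) = y)].

(* The sphere is (d-1)-dimensional. *)
Definition triangulates_sphere (R : realType) (V : finType)
    (K : {set {set V}}) (d : nat) : Prop :=
  homeomorphic (geometric_realization R K) (unit_sphere R d).

Arguments triangulates_sphere R {V} K d.

(* Graphs on n vertices whose clique complex is a (d-1)-sphere. *)
Definition flag_sphere_graph (R : realType) (d n : nat) (G : sgraph) : Prop :=
  #|G| = n /\ triangulates_sphere R (clique_complex G) d.

(* The relation k = alpha(d,n), where alpha(d,n) is the minimum of
   stability_number over flag_sphere_graph; it is a relation because this
   minimum does not exist when there is no such graph. *)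
Definition is_alpha (R : realType) (d n k : nat) : Prop :=
  (exists2 G : sgraph, flag_sphere_graph R d n G & stability_number G = k) /\
  (forall G : sgraph, flag_sphere_graph R d n G ->
     (k <= stability_number G)%N).

(* Main.v *)
(* Join two cycles a_0 .. a_(p-1) and b_0 .. b_(q-1), and subdivide in turn the
   edges a_0 b_0, .., a_(r-1) b_(r-1), calling w_i the new vertex on a_i b_i.
   Subdividing an edge turns a clique complex into the clique complex of
   another graph and keeps the homeomorphism type, so starting from the join of
   two 4-cycles, which is the cross-polytope, all these graphs are 3-spheres.
   Let p, q <= 2k+1 and r <= 2k-3. A stable set missing all b_j becomes a stable
   set of the a-cycle when each w_i is replaced by a_i, so it has at most k
   vertices. A stable set meeting both cycles meets them only in some a_i and
   b_i with i < r; then i and the indices of its w's form a stable set of a path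
   on 2k-3 vertices, of size at most k-1. Since p + q + r goes up to 6k-1, this
   gives every n. *)
Require Import Defs.
From mathcomp Require Import all_boot all_order all_algebra.
From mathcomp Require Import all_classical all_reals.
From mathcomp Require Import topology normedtype realfun.
From mathcomp Require Import zify ring lra.
Import Order.TTheory GRing.Theory Num.Theory.
Import numFieldNormedType.Exports.

Set Implicit Arguments.
Unset Strict Implicit.
Unset Printing Implicit Defensive.

Local Open Scope classical_set_scope.
Local Open Scope ring_scope.

(** * Homeomorphisms of subsets and continuity of vector-valued maps *)

Lemma homeomorphic_trans (X Y Z : topologicalType)
    (A : set X) (B : set Y) (C : set Z) :
  homeomorphic A B -> homeomorphic B C -> homeomorphic A C.
Proof.
(* Since [k] is continuous only within [T], composing needs [h] to map [S] into [T]. *)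
have cvg_comp (U V W : topologicalType) (S : set U) (T : set V)
    (h : U -> V) (k : V -> W) : set_fun S T h ->
    {within S, continuous h} -> {within T, continuous k} ->
    {within S, continuous (k \o h)}.
  move=> hST /subspace_continuousP ch /subspace_continuousP ck.
  apply/subspace_continuousP => x Sx P kP.
  apply: (@filterS _ _ (nbhs_filter x)) (ch _ Sx _ (ck _ (hST _ Sx) _ kP)).
  by move=> y /= TkP Sy; apply: TkP => //; exact: hST.
move=> [f [g [[fAB gBA] cf cg fK gK]]] [f' [g' [[fBC gCB] cf' cg' fK' gK']]].
exists (f' \o f), (g \o g'); split.
- by split=> x Sx /=; [exact/fBC/fAB|exact/gBA/gCB].
- exact: cvg_comp cf cf'.
- exact: cvg_comp cg' cg.
- by move=> x Ax /=; rewrite fK' ?fK //; exact: fAB.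
- by move=> x Cx /=; rewrite gK ?gK' //; exact: gCB.
Qed.

(** A neighbourhood of a row contains a box of neighbourhoods of its entries; there are finitely
    many entries, so the conditions on them hold simultaneously near [t]. *)
Lemma continuous_row (R : realType) (T : topologicalType) n
    (f : T -> 'rV[R]_n) t :
  (forall j, {for t, continuous (fun s => f s ord0 j)}) ->
  {for t, continuous f}.
Proof.
move=> cf P [B fB sBP].
have : \forall s \near t, forall j, B ord0 j (f s ord0 j).
  by apply: filter_forall => j; exact: (cf j _ (fB ord0 j)).
by apply: filterS => s Bs; apply: sBP => i j; rewrite ord1.
Qed.

Lemma continuous_sum (R : realType) (T : topologicalType) n
    (F : 'I_n -> T -> R) t :
  (forall i, {for t, continuous (F i)}) ->
  {for t, continuous (fun s => \sum_i F i s)}.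
Proof.
move=> cF; apply: (@cvg_big _ _ _ _ _ add_continuous _ (nbhs t)) => i _.
exact: cF.
Qed.

(** * Barycentric coordinates indexed by vertices *)

Definition bary (R : realType) (V : finType) (x : 'rV[R]_#|V|) (v : V) : R :=
  x ord0 (enum_rank v).

Definition of_bary (R : realType) (V : finType) (h : V -> R) : 'rV[R]_#|V| :=
  \row_j h (enum_val j).

Lemma of_baryE (R : realType) (V : finType) (h : V -> R) v :
  bary (of_bary h) v = h v.
Proof. by rewrite /bary mxE enum_rankK. Qed.

Lemma bary_inj (R : realType) (V : finType) (x y : 'rV[R]_#|V|) :
  bary x =1 bary y -> x = y.
Proof.
by move=> xy; apply/rowP => j; have := xy (enum_val j); rewrite /bary enum_valK.
Qed.

Lemma continuous_of_bary (R : realType) (T : topologicalType) (V : finType)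
    (h : T -> V -> R) t :
  (forall v, {for t, continuous (h ^~ v)}) ->
  {for t, continuous (fun s => of_bary (h s))}.
Proof.
move=> ch; apply: continuous_row => j.
by under [X in {for _, continuous X}]eq_fun do rewrite mxE; exact: ch.
Qed.

Lemma bary_continuous (R : realType) (V : finType) (v : V) :
  continuous (fun x : 'rV[R]_#|V| => bary x v).
Proof. by move=> x; exact: coord_continuous. Qed.

(** Being a clique is a condition on pairs, so the support condition can be checked on two nonzero
    coordinates at a time. *)
Lemma realizationP (R : realType) (G : sgraph) (x : 'rV[R]_#|G|) :
  geometric_realization R (clique_complex G) x <->
  [/\ forall v, 0 <= bary x v, \sum_v bary x v = 1
    & forall u v, u != v -> bary x u != 0 -> bary x v != 0 -> adj u v].
Proof.
have sumE : \sum_v bary x v = \sum_i x ord0 i.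
  rewrite (reindex (@enum_val G predT)) /=; last first.
    by exists enum_rank => i _; rewrite ?enum_valK ?enum_rankK.
  by apply: eq_bigr => i _; rewrite /bary enum_valK.
rewrite sumE; split=> -[x0 x1 xK]; split => //.
- by move=> v; exact: x0.
- move=> u v uv xu xv; move: xK; rewrite inE => /forall_inP /(_ u).
  rewrite inE => /(_ xu) /forall_inP /(_ v); rewrite inE => /(_ xv).
  by rewrite uv.
- by move=> i; rewrite -[i]enum_valK; exact: x0.
- rewrite inE; apply/forall_inP => u; rewrite inE => xu.
  apply/forall_inP => v; rewrite inE => xv; apply/implyP => uv.
  exact: xK.
Qed.

(** * Edge subdivision preserves the homeomorphism type *)

(* [H] is [G] with the edge [uv] subdivided at [w]. A point with minimum [m] of
   its [u]- and [v]-coordinates lies on the join of [uv]'s midpoint (with weight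
   [2m]) and of a face not containing both ends, whence the two inverse maps. *)
Section EdgeSubdivision.
Variables (R : realType) (G H : sgraph) (phi : G -> H) (u v : G) (w : H).
Hypothesis phi_inj : injective phi.
Hypothesis phi_w : forall x, phi x != w.
Hypothesis phi_surj : forall y, y != w -> exists x, phi x = y.
Hypothesis uv : adj u v.
Hypothesis adj_phi : forall x y, adj (phi x) (phi y) =
  adj x y && ~~ ((x == u) && (y == v) || (x == v) && (y == u)).
Hypothesis adj_w : forall x, adj w (phi x) =
  [|| x == u, x == v | adj x u && adj x v].

Let end_uv (x : G) : R := (x == u)%:R + (x == v)%:R.

Definition unsubdivide (y : 'rV[R]_#|H|) : 'rV[R]_#|G| :=
  of_bary (fun x => bary y (phi x) + end_uv x * (bary y w / 2)).

Definition subdivide (x : 'rV[R]_#|G|) : 'rV[R]_#|H| :=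
  of_bary (fun y =>
    if [pick z | phi z == y] is Some z
    then bary x z - end_uv z * Num.min (bary x u) (bary x v)
    else 2 * Num.min (bary x u) (bary x v)).

Let subdivide_phi x z : bary (subdivide x) (phi z) =
  bary x z - end_uv z * Num.min (bary x u) (bary x v).
Proof.
rewrite of_baryE; case: pickP => [z' /eqP/phi_inj -> //|/(_ z)].
by rewrite eqxx.
Qed.

Let subdivide_w x :
  bary (subdivide x) w = 2 * Num.min (bary x u) (bary x v).
Proof.
by rewrite of_baryE; case: pickP => // z /eqP zw; have := phi_w z;
  rewrite zw eqxx.
Qed.

Let neq_uv : u != v.
Proof. by apply/eqP => E; have := uv; rewrite E adj_irrefl. Qed.

Let sum_end (c : R) : \sum_x end_uv x * c = 2 * c.
Proof.
rewrite -mulr_suml big_split /=.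
have one z : \sum_x (x == z)%:R = 1 :> R.
  by rewrite (bigD1 z) //= eqxx big1 ?addr0 // => i /negPf ->.
by rewrite !one.
Qed.

Let sum_phi (F : H -> R) : \sum_y F y = F w + \sum_x F (phi x).
Proof.
rewrite (bigD1 w) //=; congr (_ + _).
rewrite (eq_bigl (mem (phi @: [set: G]%SET))) => [|y].
  rewrite big_imset /= => [|? ? _ _ /phi_inj//].
  by apply: eq_bigl => x; rewrite inE.
apply/idP/imsetP => [/phi_surj[x <-]|[x _ ->]]; first by exists x.
exact: phi_w.
Qed.

Let vertexP (y : H) : y = w \/ exists x, y = phi x.
Proof.
have [->|/phi_surj[x <-]] := eqVneq y w; first by left.
by right; exists x.
Qed.

Let end_uvE x : end_uv x = ((x == u) || (x == v))%:R.
Proof.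
rewrite /end_uv; have [->|] := eqVneq x u; last by rewrite add0r.
by rewrite (negPf neq_uv) addr0.
Qed.

(** Faces go to faces: a neighbour of [w] other than the two ends is adjacent to both of them, so
    moving the weight of [w] to [u] and [v] keeps the support a clique. Conversely, subtracting the
    minimum empties [u] or [v], so the removed edge never lies in a support. *)
Lemma homeomorphic_subdivision :
  homeomorphic (geometric_realization R (clique_complex H))
               (geometric_realization R (clique_complex G)).
Proof.
have vu : adj v u by rewrite adj_sym.
exists unsubdivide, subdivide; split.
- split=> [y /realizationP[y0 y1 yK]|x /realizationP[x0 x1 xK]];
    apply/realizationP; split.
  + by move=> z; rewrite of_baryE addr_ge0 // end_uvE mulr_ge0 // divr_ge0.
  + under eq_bigr do rewrite of_baryE.
    move: y1; rewrite big_split /= sum_end sum_phi [2 * _]mulrC.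
    by rewrite divfK ?pnatr_eq0 // addrC.
  (* Weight at [z] is either inherited from [phi z] or received from [w]; the four combinations for
     a pair are treated below. *)
  + have nz z : bary (unsubdivide y) z != 0 -> bary y (phi z) != 0 \/
        ((z == u) || (z == v)) /\ bary y w != 0.
      rewrite of_baryE end_uvE.
      case: (bary y (phi z) =P 0) => [->|]; last by left.
      rewrite add0r; case: orP => [zuv|]; last by rewrite mul0r eqxx.
      rewrite mul1r mulf_eq0 invr_eq0 pnatr_eq0 orbF => yw; right.
      by split=> //; exact/orP.
    have one z1 z2 : z1 != z2 -> bary y (phi z1) != 0 ->
        (z2 == u) || (z2 == v) -> bary y w != 0 -> adj z1 z2.
      move=> z12 yz1 z2uv yw.
      have : adj w (phi z1) by rewrite yK // eq_sym phi_w.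
      rewrite adj_w; case/or3P => [/eqP E|/eqP E|/andP[zu zv]].
      * by move: z12 z2uv; rewrite E eq_sym => /negPf -> /eqP ->.
      * by move: z12 z2uv; rewrite E (eq_sym v) orbC => /negPf -> /eqP ->.
      * by case/orP: z2uv => /eqP ->.
    move=> z1 z2 z12 /nz[yz1|[z1uv yw]] /nz[yz2|[z2uv yw']].
    * have := yK _ _ _ yz1 yz2; rewrite (inj_eq phi_inj) z12 adj_phi.
      by move=> /(_ isT)/andP[].
    * exact: one.
    * by rewrite adj_sym; apply: one; rewrite // eq_sym.
    * by case/orP: z1uv z12 => /eqP ->; case/orP: z2uv => /eqP -> //;
        rewrite eqxx.
  + move=> y; have [->|[z ->]] := vertexP y.
      by rewrite subdivide_w mulr_ge0 // le_min !x0.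
    rewrite subdivide_phi end_uvE subr_ge0.
    case: orP => [[/eqP->|/eqP->]|_]; rewrite ?mul1r ?mul0r //.
      by rewrite ge_min lexx.
    by rewrite ge_min lexx orbT.
  + rewrite sum_phi subdivide_w.
    under eq_bigr do rewrite subdivide_phi.
    by rewrite sumrB sum_end x1 addrC subrK.
  + have min0 z : (z == u) || (z == v) -> bary x z = 0 ->
        Num.min (bary x u) (bary x v) = 0.
      by case/orP => /eqP -> E; [rewrite E min_l|rewrite E min_r].
    have nzw : bary (subdivide x) w != 0 -> bary x u != 0 /\ bary x v != 0.
      rewrite subdivide_w mulf_eq0 pnatr_eq0 /= => m0.
      by split; apply: contraNneq m0 => E; apply/eqP; apply: min0 E;
        rewrite eqxx ?orbT.
    have nzphi z : bary (subdivide x) (phi z) != 0 -> bary x z != 0.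
      rewrite subdivide_phi end_uvE; apply: contraNneq => E.
      case: (boolP ((z == u) || (z == v))) => [zuv|_].
        by rewrite (min0 z) // E mulr0 subr0.
      by rewrite E mul0r subr0.
    have nzuv : bary (subdivide x) (phi u) != 0 ->
        bary (subdivide x) (phi v) != 0 -> False.
      rewrite !subdivide_phi !end_uvE !eqxx orbT /= !mul1r.
      by case: (leP (bary x u) (bary x v)) => _; rewrite subrr eqxx.
    have nzwphi z : bary (subdivide x) w != 0 ->
        bary (subdivide x) (phi z) != 0 -> adj w (phi z).
      move=> /nzw[xu xv] /nzphi xz; rewrite adj_w.
      have [//|zu] := eqVneq z u; have [//|zv] := eqVneq z v.
      by rewrite /= !xK.
    move=> y1 y2; have [->|[z1 ->]] := vertexP y1;
      have [->|[z2 ->]] := vertexP y2.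
    * by rewrite eqxx.
    * by move=> _; exact: nzwphi.
    * by move=> _ ? ?; rewrite adj_sym; exact: nzwphi.
    * rewrite (inj_eq phi_inj) adj_phi => z12 n1 n2.
      rewrite xK ?nzphi //=; apply/negP => /orP[] /andP[/eqP E1 /eqP E2];
        by apply: nzuv; rewrite -?E1 -?E2.
- apply: continuous_subspaceT => y.
  apply: continuous_of_bary => z.
  apply: continuousD; first exact: bary_continuous.
  apply: continuousM; first exact: cst_continuous.
  apply: continuousM; first exact: bary_continuous.
  exact: cst_continuous.
- apply: continuous_subspaceT => x.
  have cmin : {for x, continuous
      (fun x : 'rV[R]_#|G| => Num.min (bary x u) (bary x v))}.
    by apply: continuous_min; [exact: (@bary_continuous R G u)
                              |exact: (@bary_continuous R G v)].
  apply: continuous_of_bary => y; case: pickP => [z _|_].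
    apply: continuousB; first exact: bary_continuous.
    by apply: continuousM => //; exact: cst_continuous.
  by apply: continuousM => //; exact: cst_continuous.
- move=> y /realizationP[y0 y1 yK]; apply: bary_inj => z.
  (* In [H] the ends are no longer adjacent, so one of them has weight 0 in [y]; after the transfer,
     the smaller of the two weights is exactly the share coming from [w]. *)
  have minE : Num.min (bary (unsubdivide y) u) (bary (unsubdivide y) v)
      = bary y w / 2.
    rewrite !of_baryE !end_uvE !eqxx orbT !mul1r.
    have [yu|yu] := eqVneq (bary y (phi u)) 0.
      by rewrite yu add0r min_l // lerDr.
    have [yv|yv] := eqVneq (bary y (phi v)) 0.
      by rewrite yv add0r min_r // lerDr.
    have := yK _ _ _ yu yv; rewrite (inj_eq phi_inj) neq_uv adj_phi !eqxx andbF.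
    by move=> /(_ isT).
  have [->|[x ->]] := vertexP z.
    by rewrite subdivide_w minE mulrC divfK ?pnatr_eq0.
  by rewrite subdivide_phi minE of_baryE addrK.
- move=> x /realizationP[x0 x1 xK]; apply: bary_inj => z.
  rewrite of_baryE subdivide_w subdivide_phi.
  by field.
Qed.

End EdgeSubdivision.

(** * The boundary of the cross-polytope is a sphere *)

Section CrossPolytope.
Variables (R : realType) (d : nat) (G : sgraph) (c : 'I_d * bool -> G)
  (c' : G -> 'I_d * bool).
Hypotheses (cK : cancel c c') (c'K : cancel c' c).
Hypothesis adj_c : forall p q, adj (c p) (c q) = (p.1 != q.1).

Let l1 (x : 'rV[R]_d) : R := \sum_i `|x ord0 i|.
Let l2 (x : 'rV[R]_d) : R := Num.sqrt (\sum_i x ord0 i ^+ 2).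
(** The positive part of [t] for [true] and its negative part for [false]. *)
Let part (b : bool) (t : R) : R := Num.max ((-1) ^+ (~~ b) * t) 0.

Let part_ge0 b t : 0 <= part b t.
Proof. by rewrite le_max lexx orbT. Qed.

Let partD t : part true t + part false t = `|t|.
Proof.
rewrite /part expr0 expr1 mul1r mulN1r.
by have [t0|t0] := leP 0 t; have [t1|t1] := leP 0 (- t);
   rewrite ?(ger0_norm t0) ?(ltr0_norm t0); lra.
Qed.

Let partB t : part true t - part false t = t.
Proof.
rewrite /part expr0 expr1 mul1r mulN1r.
by have [t0|t0] := leP 0 t; have [t1|t1] := leP 0 (- t); lra.
Qed.

Let part_excl t : part true t != 0 -> part false t != 0 -> False.
Proof.
rewrite /part expr0 expr1 mul1r mulN1r.
have [t0|t0] := leP 0 t; have [t1|t1] := leP 0 (- t); rewrite ?eqxx //; lra.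
Qed.

Let partZ b k t : 0 <= k -> part b (k * t) = k * part b t.
Proof. by move=> k0; rewrite /part maxr_pMr // mulr0 mulrCA. Qed.

(** The vertices [c (i, true)] and [c (i, false)] stand for the i-th basis vector and its opposite;
    this is the linear map given by that placement. *)
Let diff (y : 'rV[R]_#|G|) : 'rV[R]_d :=
  \row_i (bary y (c (i, true)) - bary y (c (i, false))).

Let sum_c (F : G -> R) :
  \sum_v F v = \sum_i (F (c (i, true)) + F (c (i, false))).
Proof.
rewrite (reindex c) /=; last by exists c' => ? _.
rewrite (eq_bigr (fun p => F (c (p.1, p.2)))) => [|[]//].
rewrite -(pair_bigA _ (fun i b => F (c (i, b)))) /=.
by apply: eq_bigr => i _; rewrite big_bool.
Qed.

Let l2Z k x : 0 <= k -> l2 (k *: x) = k * l2 x.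
Proof.
move=> k0; rewrite /l2; under eq_bigr do rewrite mxE exprMn.
by rewrite -mulr_sumr sqrtrM ?sqr_ge0 // sqrtr_sqr ger0_norm.
Qed.

Let l1Z k x : 0 <= k -> l1 (k *: x) = k * l1 x.
Proof.
move=> k0; rewrite /l1 mulr_sumr; apply: eq_bigr => i _.
by rewrite mxE normrM ger0_norm.
Qed.

Let l1_ge0 x : 0 <= l1 x. Proof. exact: sumr_ge0. Qed.

Let l1_eq0 x : (l1 x == 0) = (x == 0).
Proof.
apply/eqP/eqP => [x0|->]; last first.
  by rewrite /l1 big1 // => i _; rewrite mxE normr0.
apply/rowP => i; rewrite mxE; apply/eqP; rewrite -normr_eq0.
by move: x0 => /eqP; rewrite psumr_eq0 // => /allP/(_ i (mem_index_enum _)).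
Qed.

Let l2_eq0 x : (l2 x == 0) = (x == 0).
Proof.
rewrite /l2 sqrtr_eq0; apply/idP/eqP => [x0|->]; last first.
  by rewrite big1 // => i _; rewrite mxE expr0n.
apply/rowP => i; rewrite mxE; apply/eqP; rewrite -sqrf_eq0.
have : \sum_i x ord0 i ^+ 2 == 0.
  by rewrite eq_le x0 sumr_ge0 // => j _; exact: sqr_ge0.
by rewrite psumr_eq0 => [/allP/(_ i (mem_index_enum _))//|j _]; exact: sqr_ge0.
Qed.

Let to_sphere y := (l2 (diff y))^-1 *: diff y.

Let of_sphere x : 'rV[R]_#|G| :=
  of_bary (fun v => (l1 x)^-1 * part (c' v).2 (x ord0 (c' v).1)).

Let of_sphereE x i b :
  bary (of_sphere x) (c (i, b)) = (l1 x)^-1 * part b (x ord0 i).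
Proof. by rewrite of_baryE cK. Qed.

Let diff_of_sphere x : diff (of_sphere x) = (l1 x)^-1 *: x.
Proof. by apply/rowP => i; rewrite !mxE !of_sphereE -mulrBr partB. Qed.

(** Opposite vertices are not adjacent, so at most one of them carries weight, and the two weights
    are the positive and negative parts of their difference. *)
Let realization_l1 y : geometric_realization R (clique_complex G) y ->
  l1 (diff y) = 1 /\ forall i b, bary y (c (i, b)) = part b (diff y ord0 i).
Proof.
move=> /realizationP[y0 <- yK].
have dE i b : bary y (c (i, b)) = part b (diff y ord0 i).
  have : bary y (c (i, true)) = 0 \/ bary y (c (i, false)) = 0.
    have [|yt] := eqVneq (bary y (c (i, true))) 0; first by left.
    have [|yf] := eqVneq (bary y (c (i, false))) 0; first by right.
    have := yK _ _ _ yt yf.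
    by rewrite (inj_eq (can_inj cK)) adj_c xpair_eqE eqxx => /(_ isT).
  have := y0 (c (i, true)); have := y0 (c (i, false)).
  move=> ? ? [] ?; rewrite /part; case: b;
    rewrite ?expr0 ?expr1 ?mul1r ?mulN1r mxE; case: leP; lra.
split=> //; rewrite sum_c; apply: eq_bigr => i _.
by rewrite !dE partD.
Qed.

(** [diff] identifies the realization with the unit sphere of the l1 norm, and rescaling along rays
    from the origin carries that to the Euclidean sphere and back. *)
Lemma crosspolytope_sphere : triangulates_sphere R (clique_complex G) d.
Proof.
have sphereP x : unit_sphere R d x <-> l2 x = 1.
  split=> [Sx|l2x]; first by rewrite /l2 Sx sqrtr1.
  have s0 : 0 <= \sum_i x ord0 i ^+ 2 by apply: sumr_ge0 => i _; exact: sqr_ge0.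
  by rewrite /unit_sphere /= -(sqr_sqrtr s0) -/(l2 x) l2x expr1n.
have diff_neq0 y : geometric_realization R (clique_complex G) y -> diff y != 0.
  by move=> /realization_l1[l1y _]; rewrite -l1_eq0 l1y oner_neq0.
have sphere_neq0 x : unit_sphere R d x -> x != 0.
  by move=> /sphereP l2x; rewrite -l2_eq0 l2x oner_neq0.
exists to_sphere, of_sphere; split.
- split=> [y Ky|x Sx].
    apply/sphereP; rewrite /to_sphere l2Z ?invr_ge0 ?sqrtr_ge0 //.
    by rewrite mulVf // l2_eq0 diff_neq0.
  apply/realizationP; split.
  + by move=> v; rewrite of_baryE mulr_ge0 // invr_ge0.
  + rewrite sum_c; under eq_bigr do rewrite !of_sphereE -mulrDr partD.
    by rewrite -mulr_sumr mulVf // l1_eq0 sphere_neq0.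
  + move=> u v; rewrite -(c'K u) -(c'K v); move: (c' u) (c' v) => [i b] [j b'].
    rewrite !of_sphereE (inj_eq (can_inj cK)) adj_c /= => ij.
    rewrite !mulf_eq0 !negb_or => /andP[_ n1] /andP[_ n2].
    apply/eqP => E; move: ij n1 n2; rewrite E.
    case: b; case: b'; rewrite ?eqxx // => _ n1 n2.
      exact: part_excl n1 n2.
    by case: (part_excl n2 n1).
- have cdiff i y : {for y, continuous (fun y => diff y ord0 i)}.
    under [X in {for _, continuous X}]eq_fun do rewrite mxE.
    by apply: continuousB; exact: bary_continuous.
  (* Continuity is claimed only at points of the realization, where the norm to be inverted is
     nonzero. *)
  apply: continuous_in_subspaceT => y /set_mem Ky.
  apply: continuous_row => i.
  have -> : (fun y => to_sphere y ord0 i) =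
      (fun y => (l2 (diff y))^-1 * diff y ord0 i).
    by apply/funext => ?; rewrite mxE.
  apply: continuousM; last exact: cdiff.
  apply: continuousV; first by rewrite l2_eq0 diff_neq0.
  apply: (@continuous_comp _ _ _ (fun y => \sum_j diff y ord0 j ^+ 2)
    (@Num.sqrt R)); last exact: sqrt_continuous.
  apply: continuous_sum => j.
  by apply: continuousM; exact: cdiff.
- have cx j x : {for x, continuous (fun x : 'rV[R]_d => x ord0 j)}.
    exact: coord_continuous.
  apply: continuous_in_subspaceT => x /set_mem Sx.
  apply: continuous_of_bary => v.
  apply: continuousM.
    apply: continuousV; first by rewrite l1_eq0 sphere_neq0.
    apply: continuous_sum => j.
    by apply: (@continuous_comp _ _ _ (fun x : 'rV[R]_d => x ord0 j) Num.norm);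
      [exact: cx|exact: norm_continuous].
  apply: continuous_max; last exact: cst_continuous.
  by apply: continuousM; [exact: cst_continuous|exact: cx].
- move=> y Ky; have [l1y yE] := realization_l1 Ky; apply: bary_inj => v.
  rewrite -(c'K v); move: (c' v) => [i b].
  (* [l1] and [part] are homogeneous for nonnegative factors, so the Euclidean normalization
     cancels. *)
  have k0 : 0 <= (l2 (diff y))^-1 by rewrite invr_ge0 sqrtr_ge0.
  rewrite of_sphereE l1Z // l1y mulr1 invrK mxE partZ // yE mulVKf //.
  by rewrite l2_eq0 diff_neq0.
- move=> x Sx; rewrite /to_sphere diff_of_sphere l2Z ?invr_ge0 //.
  have /sphereP -> := Sx.
  by rewrite mulr1 invrK scalerA mulfV ?scale1r // l1_eq0 sphere_neq0.
Qed.

End CrossPolytope.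

Local Open Scope nat_scope.

(** * Joins of two cycles with subdivided edges, and their stable sets *)

Lemma card_disjoint_shift (T : finType) (f : T -> T) (S : {set T}) :
  injective f -> (forall x, x \in S -> f x \notin S) -> 2 * #|S| <= #|T|.
Proof.
move=> f_inj fS; rewrite mul2n -addnn -{2}(card_imset (mem S) f_inj).
rewrite -cardsUI (_ : S :&: f @: S = finset.set0) ?cards0 ?addn0 ?max_card //.
apply/setP => y; rewrite !inE; apply/negP => /andP[yS /imsetP[x xS E]].
by move: (fS x xS); rewrite -E yS.
Qed.

(** The conjunct [i != j] rules out the loop that the modulus would create at [p = 1], so the
    relation is irreflexive for every [p]. *)
Definition cyclic (p i j : nat) : bool :=
  (i != j) && ((j == i.+1 %% p) || (i == j.+1 %% p)).

Lemma cyclicC p : symmetric (cyclic p).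
Proof. by move=> i j; rewrite /cyclic eq_sym orbC. Qed.

(** Eliminates the modulus, so that [lia] can settle adjacency in a cycle. *)
Lemma cyclicE p i j : 1 < p -> i < p -> j < p -> cyclic p i j =
  [|| j == i.+1, i == j.+1, [&& i == 0, j == p.-1 & p != 2]
    | [&& j == 0, i == p.-1 & p != 2]].
Proof.
move=> p1 ip jp; rewrite /cyclic.
have M k : k < p -> k.+1 %% p = if k == p.-1 then 0 else k.+1.
  move=> kp; case: eqP => [->|n]; first by rewrite prednK ?modnn; lia.
  by rewrite modn_small; lia.
rewrite !M //; case: (i =P p.-1); case: (j =P p.-1); lia.
Qed.

Section CyclesJoin.
Variables p q r : nat.

(* [inl (inl i)], [inl (inr j)] are the vertices a_i, b_j of the two cycles and
   [inr k] is the vertex w_k subdividing the edge a_k b_k. *)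
Definition sub_join_adj (x y : 'I_p + 'I_q + 'I_r) : bool :=
  match x, y with
  | inl (inl i), inl (inl j) => cyclic p i j
  | inl (inr i), inl (inr j) => cyclic q i j
  | inl (inl i), inl (inr j) | inl (inr j), inl (inl i) =>
    ~~ ((i == j :> nat) && (i < r))
  | inr k, inl (inl i) | inl (inl i), inr k => (i == k :> nat) || cyclic p i k
  | inr k, inl (inr j) | inl (inr j), inr k => (j == k :> nat) || cyclic q j k
  | inr k, inr l => (l == k.+1 :> nat) || (k == l.+1 :> nat)
  end.

Lemma sub_join_sym : symmetric sub_join_adj.
Proof.
move=> [[i|i]|i] [[j|j]|j] //=; first exact: cyclicC; first exact: cyclicC.
by rewrite orbC.
Qed.

Lemma sub_join_irrefl : irreflexive sub_join_adj.
Proof.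
by move=> [[i|i]|i] /=; rewrite /cyclic ?eqxx //; lia.
Qed.

Definition sub_join : sgraph := SGraph sub_join_sym sub_join_irrefl.

Lemma card_sub_join : #|sub_join| = p + q + r.
Proof. by rewrite !card_sum !card_ord. Qed.
End CyclesJoin.

Lemma cyclic_stable p (T : {set 'I_p}) : 1 < p ->
  (forall i j, i \in T -> j \in T -> ~~ cyclic p i j) -> 2 * #|T| <= p.
Proof.
move=> p1 Tst; rewrite -[leqRHS]card_ord.
apply: (card_disjoint_shift (@ordS_inj p)) => i iT.
apply/negP => /(Tst _ _ iT); rewrite /cyclic /= eqxx andbT negbK => /eqP.
have [ip|ip] := eqVneq i.+1 p; first by rewrite ip modnn; lia.
by rewrite modn_small; have := ltn_ord i; lia.
Qed.

(** Close the path into a cycle with one extra vertex: the successor of a path vertex then never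
    wraps around, and the shift argument applies on [r.+1] points. *)
Lemma path_stable r (T : {set 'I_r}) :
  (forall i j, i \in T -> j \in T -> i.+1 != j :> nat) -> 2 * #|T| <= r.+1.
Proof.
move=> Tst; have widen_inj : injective (widen_ord (leqnSn r)).
  by move=> i j /(congr1 val) /= ij; exact: val_inj.
rewrite -[leqRHS]card_ord -(card_imset (mem T) widen_inj).
apply: (card_disjoint_shift (@ordS_inj r.+1)) => x /imsetP[i iT ->].
apply/imsetP => -[j jT /(congr1 val) /= ]; rewrite modn_small ?ltnS //.
by move=> E; have := Tst _ _ iT jT; rewrite E eqxx.
Qed.

(** Replacing each path vertex by the cycle vertex of the same index gives a set disjoint from [T],
    and the union is stable in the cycle. *)
Lemma cycle_path_stable p r (T : {set 'I_p}) (U : {set 'I_r}) :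
  r < p -> 1 < p ->
  (forall i j, i \in T -> j \in T -> ~~ cyclic p i j) ->
  (forall k l, k \in U -> l \in U -> k.+1 != l :> nat) ->
  (forall i k, i \in T -> k \in U -> ~~ ((i == k :> nat) || cyclic p i k)) ->
  2 * (#|T| + #|U|) <= p.
Proof.
move=> rp p1 Tst Ust TU.
have widen_inj : injective (widen_ord (ltnW rp)).
  by move=> i j /(congr1 val) /= ij; exact: val_inj.
rewrite -(card_imset (mem U) widen_inj) -cardsUI.
rewrite [X in _ + X](_ : _ = 0) ?addn0; last first.
  apply/eqP; rewrite cards_eq0; apply/set0Pn => -[x].
  rewrite inE => /andP[xT /imsetP[k kU xk]].
  by have := TU _ _ xT kU; rewrite xk /= eqxx.
apply: cyclic_stable => // i j.
rewrite !inE => /orP[iT|/imsetP[k kU ->]] /orP[jT|/imsetP[l lU ->]] /=.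
- exact: Tst.
- by have := TU _ _ iT lU; rewrite negb_or => /andP[].
- by have := TU _ _ jT kU; rewrite negb_or cyclicC => /andP[].
(* Both indices are below [r < p], so neither is [p.-1] and the wraparound edge cannot join them. *)
- have := Ust _ _ kU lU; have := Ust _ _ lU kU.
  have kr := ltn_ord k; have lr := ltn_ord l; rewrite cyclicE; lia.
Qed.

Section Stability.
Variables p q r k : nat.
Hypotheses (p1 : 1 < p) (q1 : 1 < q).
Hypotheses (pk : p <= (2 * k).+1) (qk : q <= (2 * k).+1).
Hypotheses (rp : r < p) (rq : r < q) (rk : 0 < r -> r + 3 <= 2 * k).

Lemma stable_sub_join (S : {set sub_join p q r}) : stable_set S -> #|S| <= k.
Proof.
move=> /forall_inP stS.
have {}stS x y : x \in S -> y \in S -> ~~ sub_join_adj x y.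
  by move=> xS yS; exact: (forall_inP (stS x xS)).
pose SA := [set i | inl (inl i) \in S]%SET.
pose SB := [set i | inl (inr i) \in S]%SET.
pose SW := [set i | inr i \in S]%SET.
have SE : #|S| = #|SA| + #|SB| + #|SW|.
  rewrite -!sum1_card !big_mkcond !big_sumType /=.
  by congr (_ + _ + _); rewrite [RHS]big_mkcond; apply: eq_bigr => i _;
    rewrite inE.
have SWst i j : i \in SW -> j \in SW -> i.+1 != j :> nat.
  rewrite !inE => iS jS; have := stS _ _ iS jS.
  by rewrite /= negb_or eq_sym => /andP[].
(* With no b-vertex, everything projects to the a-cycle, and [p <= (2 * k).+1] halves to at most
   [k]. *)
have [SB0|/set0Pn[j jB]] := eqVneq SB finset.set0.
  suff: 2 * (#|SA| + #|SW|) <= p by rewrite SE SB0 cards0; lia.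
  apply: cycle_path_stable => // i j; rewrite !inE => iS jS;
    exact: (stS _ _ iS jS).
have [SA0|/set0Pn[i iA]] := eqVneq SA finset.set0.
  suff: 2 * (#|SB| + #|SW|) <= q by rewrite SE SA0 cards0; lia.
  apply: cycle_path_stable => // i' j'; rewrite !inE => iS jS;
    exact: (stS _ _ iS jS).
(* An a-vertex and a b-vertex are non-adjacent only when the edge between them was subdivided, so a
   stable set meeting both cycles has exactly one vertex in each, with equal index. *)
have AB i' j' : i' \in SA -> j' \in SB -> (i' == j' :> nat) && (i' < r).
  by rewrite !inE => iS jS; have := stS _ _ iS jS; rewrite negbK.
have /andP[/eqP ij ir] := AB _ _ iA jB.
have SA1 : SA = [set i]%SET.
  apply/setP => i'; rewrite finset.in_set1; apply/idP/eqP => [i'A|->//].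
  by have /andP[/eqP i'j _] := AB _ _ i'A jB; apply: val_inj; rewrite /= ij.
have SB1 : SB = [set j]%SET.
  apply/setP => j'; rewrite finset.in_set1; apply/idP/eqP => [j'B|->//].
  by have /andP[/eqP i'j _] := AB _ _ iA j'B; apply: val_inj; rewrite /= -ij.
have WA l : l \in SW -> ~~ ((i == l :> nat) || cyclic p i l).
  by move: iA; rewrite !inE => iS lS; exact: (stS _ _ iS lS).
pose l0 := Ordinal ir.
have l0W : l0 \notin SW.
  by apply/negP => /WA; rewrite /= eqxx.
(* Since [l0] is in the range of subdivided indices, [r] is positive and [rk] applies: the path
   bound gives #|SW| + 1 <= k - 1, and [S] has #|SW| + 2 elements. *)
have : 2 * #|l0 |: SW| <= r.+1.
  apply: path_stable => l m; rewrite !finset.in_setU1.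
  have Wl0 l' : l' \in SW -> (l'.+1 != l0 :> nat) && (l0.+1 != l' :> nat).
    move=> /WA; have ip := ltn_ord i; have lr := ltn_ord l'.
    by rewrite cyclicE /=; lia.
  move=> /orP[/eqP ->|lW] /orP[/eqP ->|mW].
  - by rewrite eqn_leq ltnn.
  - by have /andP[] := Wl0 m mW.
  - by have /andP[] := Wl0 l lW.
  - exact: SWst.
rewrite cardsU1 l0W SE SA1 SB1 !cards1; lia.
Qed.

End Stability.

(** * The subdivided joins are 3-spheres *)

Definition sub_join_sphere (R : realType) p q r :=
  triangulates_sphere R (clique_complex (sub_join p q r)) 4.

Lemma sub_join_sphere_base (R : realType) : sub_join_sphere R 4 4 0.
Proof.
(* Antipodal pairs are the opposite vertices [i] and [i + 2] of a 4-cycle: axes 0 and 1 come from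
   the first cycle, axes 2 and 3 from the second. *)
pose c (x : 'I_4 * bool) : sub_join 4 4 0 :=
  if x.1 < 2 then inl (inl (inord (x.1 + 2 * x.2)))
  else inl (inr (inord (x.1 - 2 + 2 * x.2))).
pose c' (x : sub_join 4 4 0) : 'I_4 * bool :=
  match x with
  | inl (inl i) => (inord (i %% 2), 2 <= i)
  | inl (inr i) => (inord (2 + i %% 2), 2 <= i)
  | inr _ => (ord0, true)
  end.
have ord4P (P : 'I_4 -> Prop) : P (inord 0) -> P (inord 1) -> P (inord 2) ->
    P (inord 3) -> forall i, P i.
  move=> P0 P1 P2 P3 i; rewrite -(inord_val i).
  by case: i => -[|[|[|[|]]]].
have cK : cancel c c'.
  case=> i; elim/ord4P: i => -[]; rewrite /c /=; repeat rewrite inordK //=.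
have c'K : cancel c' c.
  move=> [[i|i]|[]//]; elim/ord4P: i; rewrite /c /c' /=;
    repeat rewrite inordK //=.
apply: (crosspolytope_sphere R cK c'K) => -[i b] [j b'].
rewrite -(inj_eq val_inj) /c /=.
elim/ord4P: i; elim/ord4P: j; case: b; case: b';
  by repeat rewrite inordK //=.
Qed.

Lemma sub_join_eqE p q r (x y : sub_join p q r) : (x == y) =
  match x, y with
  | inl (inl i), inl (inl j) => i == j :> nat
  | inl (inr i), inl (inr j) => i == j :> nat
  | inr i, inr j => i == j :> nat
  | _, _ => false
  end.
Proof. by move: x y => [[i|i]|i] [[j|j]|j]. Qed.

(** Subdivides a_r b_r, whose common neighbours are the cycle neighbours of a_r and of b_r and, if r
    > 0, w_(r-1). The bounds keep [r] off the last index of each cycle, so wraparound adds no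
    adjacency between w_0 and a_r or b_r. *)
Lemma sub_join_sphere_w (R : realType) p q r : r.+1 < p -> r.+1 < q ->
  sub_join_sphere R p q r -> sub_join_sphere R p q r.+1.
Proof.
move=> rp rq; apply: homeomorphic_trans.
pose phi (x : sub_join p q r) : sub_join p q r.+1 :=
  match x with inl y => inl y | inr k => inr (widen_ord (leqnSn r) k) end.
apply: (@homeomorphic_subdivision R (sub_join p q r) (sub_join p q r.+1) phi
  (inl (inl (Ordinal (ltnW rp)))) (inl (inr (Ordinal (ltnW rq))))
  (inr ord_max)).
- move=> [x|x] [y|y] //= [E]; first by rewrite E.
  by apply: (congr1 inr); exact: val_inj.
- move=> [x|x] //; apply/eqP => -[xr]; have := ltn_ord x; lia.
- move=> [y|y]; first by exists (inl y).
  move=> yw; have yr : y < r.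
    have := ltn_ord y; rewrite ltnS leq_eqVlt => /orP[/eqP E|//].
    by move: yw; rewrite (_ : y = ord_max) ?eqxx //; apply: val_inj.
  by exists (inr (Ordinal yr)); apply: (congr1 inr); exact: val_inj.
- by rewrite /= ltnn andbF.
- by move=> [[i|i]|i] [[j|j]|j]; rewrite !sub_join_eqE /=; lia.
- move=> [[i|i]|i]; have il := ltn_ord i;
    rewrite !sub_join_eqE /= ?cyclicE /=; lia.
Qed.

(** Subdivides the edge from a_(p-1) to a_0. As [3 < p], these ends have no common neighbour in
    their cycle, so the new vertex sees just them and all b_j. *)
Lemma sub_join_sphere_a (R : realType) p q : 3 < p ->
  sub_join_sphere R p q 0 -> sub_join_sphere R p.+1 q 0.
Proof.
move=> p3; apply: homeomorphic_trans.
have p0 : 0 < p by lia.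
have p1 : p.-1 < p by lia.
pose phi (x : sub_join p q 0) : sub_join p.+1 q 0 :=
  match x with
  | inl (inl i) => inl (inl (widen_ord (leqnSn p) i))
  | inl (inr j) => inl (inr j)
  | inr k => inr k
  end.
apply: (@homeomorphic_subdivision R (sub_join p q 0) (sub_join p.+1 q 0) phi
  (inl (inl (Ordinal p1))) (inl (inl (Ordinal p0))) (inl (inl ord_max))).
- by move=> x y /eqP xy; apply/eqP; move: x y xy => [[i|i]|[]//] [[j|j]|[]//];
    rewrite !sub_join_eqE.
- by move=> [[i|i]|[]//]; have il := ltn_ord i; rewrite sub_join_eqE //=; lia.
- move=> [[i|j]|[]//]; last by exists (inl (inr j)).
  rewrite sub_join_eqE /= => ip.
  have {}ip : i < p by have := ltn_ord i; lia.
  by exists (inl (inl (Ordinal ip))); apply/eqP; rewrite sub_join_eqE /= eqxx.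
- by rewrite /= cyclicE; lia.
- move=> [[i|i]|[]//] [[j|j]|[]//]; have il := ltn_ord i; have jl := ltn_ord j;
    rewrite !sub_join_eqE /= ?(@cyclicE p) ?(@cyclicE p.+1); lia.
- move=> [[i|i]|[]//]; have il := ltn_ord i;
    rewrite !sub_join_eqE /= ?(@cyclicE p) ?(@cyclicE p.+1); lia.
Qed.

Lemma sub_join_sphere_b (R : realType) p q : 3 < q ->
  sub_join_sphere R p q 0 -> sub_join_sphere R p q.+1 0.
Proof.
move=> q3; apply: homeomorphic_trans.
have q0 : 0 < q by lia.
have q1 : q.-1 < q by lia.
pose phi (x : sub_join p q 0) : sub_join p q.+1 0 :=
  match x with
  | inl (inl i) => inl (inl i)
  | inl (inr j) => inl (inr (widen_ord (leqnSn q) j))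
  | inr k => inr k
  end.
apply: (@homeomorphic_subdivision R (sub_join p q 0) (sub_join p q.+1 0) phi
  (inl (inr (Ordinal q1))) (inl (inr (Ordinal q0))) (inl (inr ord_max))).
- by move=> x y /eqP xy; apply/eqP; move: x y xy => [[i|i]|[]//] [[j|j]|[]//];
    rewrite !sub_join_eqE.
- by move=> [[i|i]|[]//]; have il := ltn_ord i; rewrite sub_join_eqE //=; lia.
- move=> [[j|i]|[]//]; first by exists (inl (inl j)).
  rewrite sub_join_eqE /= => iq.
  have {}iq : i < q by have := ltn_ord i; lia.
  by exists (inl (inr (Ordinal iq))); apply/eqP; rewrite sub_join_eqE /= eqxx.
- by rewrite /= cyclicE; lia.
- move=> [[i|i]|[]//] [[j|j]|[]//]; have il := ltn_ord i; have jl := ltn_ord j;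
    rewrite !sub_join_eqE /= ?(@cyclicE q) ?(@cyclicE q.+1); lia.
- move=> [[i|i]|[]//]; have il := ltn_ord i;
    rewrite !sub_join_eqE /= ?(@cyclicE q) ?(@cyclicE q.+1); lia.
Qed.

Lemma sub_join_sphereP (R : realType) p q r :
  3 < p -> 3 < q -> r < p -> r < q -> sub_join_sphere R p q r.
Proof.
move=> p3 q3; elim: r => [_ _|r IHr rp rq]; last first.
  by apply: sub_join_sphere_w => //; apply: IHr; exact: ltnW.
(* The cycles are lengthened from 4 while no w_i is present; the edges a_i b_i are subdivided only
   afterwards. *)
rewrite -(subnK p3) -(subnK q3); elim: (p - 4) => [|m IHm].
  elim: (q - 4) => [|m IHm]; first exact: sub_join_sphere_base.
  by rewrite addSn; apply: sub_join_sphere_b => //; rewrite ltn_addl.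
by rewrite addSn; apply: sub_join_sphere_a => //; rewrite ltn_addl.
Qed.

(** * Choice of the parameters and the bound on the minimum *)

Lemma exists_sub_join_small_stability n : 7 < n -> exists p q r,
  [/\ 3 < p, 3 < q, r < p & r < q] /\ p + q + r = n /\
  (stability_number (sub_join p q r) <= n %/ 6 + 1).
Proof.
(* For natural [n] this is the ceiling of (n + 1) / 6. *)
move=> n7; set k := n %/ 6 + 1.
have [kn nk] : 6 * k <= n + 6 /\ n < 6 * k by rewrite /k; lia.
have small p q r : 1 < p -> 1 < q -> r < p -> r < q ->
    p <= (2 * k).+1 -> q <= (2 * k).+1 -> (0 < r -> r + 3 <= 2 * k) ->
    stability_number (sub_join p q r) <= k.
  move=> *; apply/bigmax_leqP => S; exact: stable_sub_join.
(* Up to 4k + 2 vertices fit in two cycles of length at most 2k + 1. Beyond that, both cycles are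
   full and the excess, at most 2k - 3 because n < 6k, goes into subdivisions. *)
have [nk'|nk'] := leqP n (4 * k + 2).
  exists (n %/ 2), (n - n %/ 2), 0; split; first by split; lia.
  by split; [|apply: small]; lia.
exists (2 * k + 1), (2 * k + 1), (n - (4 * k + 2)); split; first by split; lia.
by split; [|apply: small]; lia.
Qed.

Local Open Scope ring_scope.

(** A nonempty set of naturals has a least element; [asbool] makes the property boolean, as
    [ex_minn] requires. *)
Lemma is_alpha_exists (R : realType) d n (G : sgraph) :
  flag_sphere_graph R d n G ->
  exists2 k, is_alpha R d n k & (k <= stability_number G)%N.
Proof.
move=> Gn.
pose P k :=
  `[< exists2 H, flag_sphere_graph R d n H & stability_number H = k >].
have PH H : flag_sphere_graph R d n H -> P (stability_number H).
  by move=> Hn; apply/asboolP; exists H.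
have exP : exists k, P k by exists (stability_number G); exact: PH.
case: (ex_minnP exP) => k /asboolP Pk kmin.
by exists k; [split=> // H /PH|apply: kmin; exact: PH]; exact: kmin.
Qed.

Theorem theorem2p5 (R : realType) (n : nat) (hn : (8 <= n)%N) :
  exists2 k : nat, is_alpha R 4 n k &
    k%:Z <= Num.ceil ((n%:R + 1) / 6%:R : rat).
Proof.
have [p [q [r [[p3 q3 rp rq] [nE small]]]]] :=
  exists_sub_join_small_stability hn.
have [|k ak kG] := @is_alpha_exists R 4 n (sub_join p q r).
  by split; [rewrite card_sub_join|exact: sub_join_sphereP].
exists k => //; have kn := leq_trans kG small.
have [->//|k0] := posnP k.
  rewrite ceil_ge0; apply: (@lt_le_trans _ _ 0) => //.
  by rewrite divr_ge0 // addr_ge0.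
(* An integer is strictly below a ceiling exactly when it is below the number itself, so the goal
   becomes k - 1 < (n + 1) / 6. *)
rewrite -(prednK k0) -addn1 PoszD lezD1 ceil_gt_int.
rewrite ltr_pdivlMr //.
have : (k.-1 * 6 < n + 1)%N by have := leq_divM n 6; lia.
by rewrite -(ltr_nat rat) natrD natrM.
Qed.
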